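(* Let $d\ge1$, let $\Sigma_{\mathrm{aug}}$ be a symmetric positive definite $d\times d$ matrix, let $C\ge1$, $\pi_1,\dots,\pi_C\in[0,1]$ with $\sum_c\pi_c=1$, $\mu_1,\dots,\mu_C\in\mathbb{R}^d$, and $\Sigma_1,\dots,\Sigma_C$ symmetric positive definite $d\times d$ matrices. Let the prior on $\bar z=(z,z')$ be $$p_\psi(\bar z)=\varphi\big(0;\,z-z',\,2\Sigma_{\mathrm{aug}}\big)\sum_{c=1}^C\pi_c\,\varphi\Big(\tfrac{z+z'}{2};\,\mu_c,\,\Sigma_c+\tfrac12\Sigma_{\mathrm{aug}}\Big).$$ Let $\mu_x,\mu_{x'}\in\mathbb{R}^d$, let $\Sigma_x,\Sigma_{x'}$ be positive definite diagonal $d\times d$ matrices, and let $q(\bar z\mid\bar x)=\varphi(z;\mu_x,\Sigma_x)\,\varphi(z';\mu_{x'},\Sigma_{x'})$. Let $p_\theta(\bar x\mid\bar z)$ be a conditional likelihood and $\mathcal{L}(\bar x)=\mathbb{E}_{\bar z\sim q(\bar z\mid\bar x)}[\log p_\theta(\bar x\mid\bar z)]-D_{\mathrm{KL}}(q(\bar z\mid\bar x)\,\|\,p_\psi(\bar z))$. Then $$\mathcal{L}(\bar x)=\mathbb{E}_{q(\bar z\mid\bar x)}\big[\log p_\theta(\bar x\mid\bar z)\big]+\mathbb{E}_{q(\bar z\mid\bar x)}\Big[\log\sum_{c=1}^C\pi_c\,\varphi\Big(\tfrac{z+z'}{2};\mu_c,\Sigma_c+\tfrac12\Sigma_{\mathrm{aug}}\Big)\Big]$$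 $$-\tfrac14\Big\{\operatorname{Tr}\big(\Sigma_{\mathrm{aug}}^{-1}(\Sigma_x+\Sigma_{x'})\big)+(\mu_x-\mu_{x'})^\top\Sigma_{\mathrm{aug}}^{-1}(\mu_x-\mu_{x'})\Big\}+\tfrac12\big(\log\det\Sigma_x+\log\det\Sigma_{x'}\big)+d+\tfrac d2\log\pi-\tfrac12\log\det\Sigma_{\mathrm{aug}}.$$
   Context: For $v,m\in\mathbb{R}^d$ and a symmetric positive definite matrix $S$, $\varphi(v;m,S)=\exp(-\tfrac12(v-m)^\top S^{-1}(v-m))/\sqrt{\det(2\pi S)}$ is the Gaussian density. $\bar x=(x,x')$ is a pair of data points, and $D_{\mathrm{KL}}(q\|p)=\mathbb{E}_q[\log q-\log p]$. This prior is the marginal of $\int\varphi(z;\tilde z,\Sigma_{\mathrm{aug}})\varphi(z';\tilde z,\Sigma_{\mathrm{aug}})\sum_c\pi_c\varphi(\tilde z;\mu_c,\Sigma_c)\,d\tilde z$. *)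

(* Defs.v *)
From HB Require Import structures.
From mathcomp Require Import all_boot all_order all_algebra.
From mathcomp Require Import all_classical all_reals all_analysis.
Set Implicit Arguments. Unset Strict Implicit. Unset Printing Implicit Defensive.
Import Order.TTheory GRing.Theory Num.Theory.
Local Open Scope ring_scope.

(* Lebesgue integral over R^n (vectors are row vectors 'rV[R]_n), realised as
   the iterated one-dimensional Lebesgue integral over the coordinates
   (equal to the n-dimensional Lebesgue integral for integrable functions,
   by Fubini). *)
Fixpoint lebint (R : realType) (n : nat) : ('rV[R]_n -> \bar R) -> \bar R :=
  match n return ('rV[R]_n -> \bar R) -> \bar R with
  | 0 => fun f => f 0
  | n'.+1 => fun f =>
      (\int[@lebesgue_measure R]_(x in [set: R])
          lebint (fun v : 'rV[R]_n' => f (row_mx (\row_(i < 1) x) v)))%E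
  end.

Definition qform (R : realType) (n : nat) (v : 'rV[R]_n) (S : 'M[R]_n) : R :=
  (v *m S *m v^T) 0 0.

Definition sym_posdef (R : realType) (n : nat) (S : 'M[R]_n) : Prop :=
  S^T = S /\ forall v : 'rV[R]_n, v != 0 -> 0 < qform v S.

Definition diag_posdef (R : realType) (n : nat) (S : 'M[R]_n) : Prop :=
  is_diag_mx S /\ forall i, 0 < S i i.

Definition gauss (R : realType) (n : nat) (v m : 'rV[R]_n) (S : 'M[R]_n) : R :=
  expR (- (1/2) * qform (v - m) (invmx S)) / Num.sqrt (\det ((2 * pi) *: S)).

Definition mixture (R : realType) (d C : nat) (w : 'I_C -> R)
    (mu : 'I_C -> 'rV[R]_d) (Sig : 'I_C -> 'M[R]_d) (Saug : 'M[R]_d)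
    (z z' : 'rV[R]_d) : R :=
  \sum_(c < C) w c * gauss ((1/2) *: (z + z')) (mu c) (Sig c + (1/2) *: Saug).

Definition prior (R : realType) (d C : nat) (w : 'I_C -> R)
    (mu : 'I_C -> 'rV[R]_d) (Sig : 'I_C -> 'M[R]_d) (Saug : 'M[R]_d)
    (z z' : 'rV[R]_d) : R :=
  gauss 0 (z - z') (2 *: Saug) * mixture w mu Sig Saug z z'.

Definition qpost (R : realType) (d : nat) (mx mx' : 'rV[R]_d) (Sx Sx' : 'M[R]_d)
    (z z' : 'rV[R]_d) : R :=
  gauss z mx Sx * gauss z' mx' Sx'.

Definition Eq (R : realType) (d : nat) (mx mx' : 'rV[R]_d) (Sx Sx' : 'M[R]_d)
    (f : 'rV[R]_d -> 'rV[R]_d -> R) : \bar R :=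
  lebint (fun z => lebint (fun z' => (qpost mx mx' Sx Sx' z z' * f z z')%:E)).

Definition KLq (R : realType) (d C : nat) (mx mx' : 'rV[R]_d) (Sx Sx' : 'M[R]_d)
    (w : 'I_C -> R) (mu : 'I_C -> 'rV[R]_d) (Sig : 'I_C -> 'M[R]_d)
    (Saug : 'M[R]_d) : \bar R :=
  Eq mx mx' Sx Sx' (fun z z' =>
    ln (qpost mx mx' Sx Sx' z z') - ln (prior w mu Sig Saug z z')).

(* ELBO: E_q[log p_theta(xbar | zbar)] - KL(q || p_psi); plik z z' is
   p_theta(xbar | (z, z')) for the fixed data pair xbar. *)
Definition elbo (R : realType) (d C : nat) (plik : 'rV[R]_d -> 'rV[R]_d -> R)
    (mx mx' : 'rV[R]_d) (Sx Sx' : 'M[R]_d)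
    (w : 'I_C -> R) (mu : 'I_C -> 'rV[R]_d) (Sig : 'I_C -> 'M[R]_d)
    (Saug : 'M[R]_d) : \bar R :=
  (Eq mx mx' Sx Sx' (fun z z' => ln (plik z z')) - KLq mx mx' Sx Sx' w mu Sig Saug)%E.

(* Main.v *)
(* Concatenating [z] and [z'] turns the two nested expectations into one
   iterated integral over [R^(2d)] against a product of one-dimensional normal
   densities, because the posterior covariances are diagonal. The logarithms of
   the Gaussian factors of [q] and of the prior are quadratic, so the moments
   1, 0, sigma^2 of the one-dimensional normal density give their expectations;
   each expectation is a value of the form at the mean plus a trace. The log of
   the mixture is bounded above by a constant and below by the log of one
   weighted component, hence it has quadratic growth and a finite expectation,
   which makes it legitimate to split the Kullback-Leibler integral. *)
Require Import Defs.
From HB Require Import structures.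
From mathcomp Require Import all_boot all_order all_algebra.
From mathcomp Require Import all_classical all_reals all_analysis.
From mathcomp Require Import measurable_realfun.
From mathcomp Require Import ring lra.
Import Order.TTheory GRing.Theory Num.Theory.
Import numFieldNormedType.Exports.
Local Open Scope ring_scope.

(** * Iterated integrals over row vectors: concatenation and measurability *)

Definition cons_row {R : realType} {n} (x : R) (v : 'rV[R]_n) : 'rV[R]_n.+1 :=
  row_mx (\row_(i < 1) x) v.

Lemma cons_row0 {R : realType} {n} (x : R) (v : 'rV[R]_n) :
  cons_row x v 0 ord0 = x.
Proof.
rewrite /cons_row (_ : ord0 = lshift n (ord0 : 'I_1)); last exact: val_inj.
by rewrite [LHS]row_mxEl mxE.
Qed.

Lemma cons_rowS {R : realType} {n} (x : R) (v : 'rV[R]_n) i :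
  cons_row x v 0 (lift ord0 i) = v 0 i.
Proof.
rewrite /cons_row (_ : lift ord0 i = rshift 1 i); last exact: val_inj.
exact: row_mxEr.
Qed.

Lemma lebintS {R : realType} {n} (f : 'rV[R]_n.+1 -> \bar R) :
  lebint f = (\int[lebesgue_measure]_x lebint (fun v => f (cons_row x v)))%E.
Proof. by []. Qed.

Lemma eq_lebint {R : realType} n (f g : 'rV[R]_n -> \bar R) :
  f =1 g -> lebint f = lebint g.
Proof. by move=> /funext ->. Qed.

(** Both sides integrate over the coordinates of [z] and then those of [z'], in the same order, so
    no integrals are exchanged. Induction on [n] only tracks how the first coordinate sits in the
    concatenated vector. *)
Lemma lebint_row_mx {R : realType} n m (F : 'rV[R]_n -> 'rV[R]_m -> \bar R) :
  lebint (fun z => lebint (F z)) =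
  lebint (fun v : 'rV[R]_(n + m) => F (lsubmx v) (rsubmx v)).
Proof.
elim: n F => [F|n IHn F].
  rewrite /=; apply: eq_lebint => v; congr F.
    by apply/rowP => -[].
  by apply/rowP => j; rewrite mxE; congr (v _ _); exact: val_inj.
rewrite lebintS [RHS]lebintS; apply: eq_integral => x _.
rewrite IHn; apply: eq_lebint => v; congr F; apply/rowP => j.
  rewrite [RHS]mxE; case: (unliftP ord0 j) => [i ->|->].
    rewrite cons_rowS mxE.
    rewrite (_ : lshift m (lift ord0 i) = lift ord0 (lshift m i)); last exact: val_inj.
    by rewrite cons_rowS.
  rewrite cons_row0 (_ : lshift m ord0 = ord0); last exact: val_inj.
  by rewrite cons_row0.
rewrite [LHS]mxE [RHS]mxE.
rewrite (_ : rshift n.+1 j = lift ord0 (rshift n j)); last exact: val_inj.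
by rewrite cons_rowS.
Qed.

(* ['rV_n] carries no sigma-algebra here: measurability is tested along all
   coordinatewise measurable families of vectors, so that slicing off a
   coordinate and measurability in a parameter come for free. *)
Definition mvmeasurable {R : realType} {n} (f : 'rV[R]_n -> R) : Prop :=
  forall d (T : measurableType d) (c : T -> 'rV[R]_n),
    (forall i, measurable_fun setT (fun t => c t 0 i)) ->
    measurable_fun setT (fun t => f (c t)).

Lemma measurable_cons_row {R : realType} n d (T : measurableType d)
    (x : T -> R) (v : T -> 'rV[R]_n) :
  measurable_fun setT x -> (forall i, measurable_fun setT (fun t => v t 0 i)) ->
  forall i, measurable_fun setT (fun t => cons_row (x t) (v t) 0 i).
Proof.
move=> mx mv i; case: (unliftP ord0 i) => [j ->|->].
  by under eq_fun do rewrite cons_rowS; exact: mv.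
by under eq_fun do rewrite cons_row0.
Qed.

(** Tonelli gives measurability for nonnegative integrands. The integral is by definition the
    difference of those of the positive and negative parts, so the signed case follows. *)
Lemma measurable_integral_prod {R : realType} d1 d2 (T1 : measurableType d1)
    (T2 : measurableType d2) (m : {sigma_finite_measure set T2 -> \bar R})
    (F : T1 * T2 -> \bar R) :
  measurable_fun setT F -> measurable_fun setT (fun x => \int[m]_y F (x, y))%E.
Proof.
move=> mF.
have -> : (fun x => \int[m]_y F (x, y))%E =
    ((fun x => \int[m]_y (F^\+ (x, y))) \- (fun x => \int[m]_y (F^\- (x, y))))%E.
  apply/funext => x; rewrite [LHS]integralE.
  under eq_integral do rewrite (funepos_comp F (pair x))/=.
  by under [X in (_ - X)%E = _]eq_integral do rewrite (funeneg_comp F (pair x))/=.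
apply: emeasurable_funB; apply: measurable_fun_fubini_tonelli_F => //.
- exact: measurable_funepos.
- exact: measurable_funeneg.
Qed.

(** The induction moves the outermost integration variable into the parameter space, which becomes
    [T * R]. The hypothesis is closed under this move because it quantifies over all measurable
    substitutions [g] and [c]. *)
Lemma measurable_lebint {R : realType} n d (T : measurableType d)
    (f : T -> 'rV[R]_n -> R) :
  (forall d' (T' : measurableType d') (g : T' -> T) (c : T' -> 'rV[R]_n),
    measurable_fun setT g -> (forall i, measurable_fun setT (fun t => c t 0 i)) ->
    measurable_fun setT (fun t => f (g t) (c t))) ->
  measurable_fun setT (fun t => lebint (fun v => (f t v)%:E)).
Proof.
elim: n d T f => [|n IHn] d T f mf.
  apply/measurable_EFinP; apply: (mf _ T id (fun=> 0)) => // -[].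
pose F (p : T * R) := lebint (fun v => (f p.1 (cons_row p.2 v))%:E).
have mF : measurable_fun setT F.
  apply: IHn => d' T' g c mg mc.
  apply: (mf _ _ (fun t => (g t).1) (fun t => cons_row (g t).2 (c t))).
    exact: measurableT_comp mg.
  by apply: measurable_cons_row => //; exact: measurableT_comp mg.
exact: (@measurable_integral_prod _ _ _ _ _ lebesgue_measure F mF).
Qed.

(** * Integrability for iterated integrals *)

(** Every slice, and not just almost every one, has to be integrable. Linearity then holds pointwise
    at each level, with no null sets to carry through the recursion. *)
Fixpoint mvintegrable {R : realType} {n} : ('rV[R]_n -> R) -> Prop :=
  match n return ('rV[R]_n -> R) -> Prop with
  | 0 => fun _ => True
  | n'.+1 => fun f =>
      (forall x, mvintegrable (fun v : 'rV[R]_n' => f (cons_row x v))) /\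
      lebesgue_measure.-integrable setT
        (fun x => lebint (fun v : 'rV[R]_n' => (f (cons_row x v))%:E))
  end.

Lemma lebint_fin_num {R : realType} n (f : 'rV[R]_n -> R) :
  mvintegrable f -> lebint (fun v => (f v)%:E) \is a fin_num.
Proof. by case: n f => [//|n] f [_ fi]; exact: integrable_fin_num. Qed.

Lemma mvintegrableD {R : realType} n (f g : 'rV[R]_n -> R) :
  mvintegrable f -> mvintegrable g ->
  mvintegrable (fun v => f v + g v) /\
  (lebint (fun v => (f v + g v)%:E) =
   lebint (fun v => (f v)%:E) + lebint (fun v => (g v)%:E))%E.
Proof.
elim: n f g => [//|n IHn] f g [fx fi] [gx gi].
have E x := (IHn _ _ (fx x) (gx x)).2.
split; last first.
  rewrite !lebintS -integralD//.
  by apply: eq_integral => x _; rewrite E.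
split; first by move=> x; exact: (IHn _ _ (fx x) (gx x)).1.
by under eq_fun do rewrite E; exact: integrableD.
Qed.

Lemma mvintegrableZ {R : realType} n (k : R) (f : 'rV[R]_n -> R) :
  mvintegrable f ->
  mvintegrable (fun v => k * f v) /\
  (lebint (fun v => (k * f v)%:E) = k%:E * lebint (fun v => (f v)%:E))%E.
Proof.
elim: n f => [//|n IHn] f [fx fi].
have E x := (IHn _ (fx x)).2.
split; last first.
  rewrite !lebintS -integralZl//.
  by apply: eq_integral => x _; rewrite E.
split; first by move=> x; exact: (IHn _ (fx x)).1.
by under eq_fun do rewrite E; exact: integrableZl.
Qed.

Lemma lebint_le {R : realType} n (f g : 'rV[R]_n -> R) :
  mvintegrable f -> mvintegrable g -> (forall v, f v <= g v) ->
  (lebint (fun v => (f v)%:E) <= lebint (fun v => (g v)%:E))%E.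
Proof.
elim: n f g => [|n IHn] f g; first by move=> _ _ fg; rewrite lee_fin.
move=> [fx fi] [gx gi] fg.
by rewrite !lebintS; apply: le_integral => // x _; exact: (IHn _ _ (fx x) (gx x)).
Qed.

(** The slices are integrable by induction. The inner integral of [f] is then bounded in absolute
    value by that of [g], by comparing both [f] and [- f] with [g]. *)
Lemma mvintegrable_dominated {R : realType} n (f g : 'rV[R]_n -> R) :
  mvmeasurable f -> (forall v, `|f v| <= g v) -> mvintegrable g -> mvintegrable f.
Proof.
elim: n f g => [//|n IHn] f g mf fg [gx gi].
have mfx x : mvmeasurable (fun v => f (cons_row x v)).
  by move=> d T c mc; apply: mf; exact: measurable_cons_row.
have fx x : mvintegrable (fun v => f (cons_row x v)).
  exact: (IHn _ _ (mfx x) (fun v => fg _) (gx x)).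
split=> //.
apply: le_integrable gi => //.
  apply: measurable_lebint => d T x c mx mc; apply: mf.
  exact: measurable_cons_row.
move=> x _.
have [fNx lN] := mvintegrableZ n (-1) _ (fx x).
have g0 v : 0 <= g v by exact: le_trans (fg v).
rewrite [leRHS]gee0_abs; last first.
  (* The inner integral of [g] is nonnegative: the zero function is taken as [0 * g], so that its
     integrability and its zero integral are at hand. *)
  have [z0 z0E] := mvintegrableZ n 0 _ (gx x).
  move: z0E; rewrite mul0e => <-; apply: (lebint_le _ _ _ z0 (gx x)) => v.
  by rewrite mul0r.
have [/gee0_abs ->|/ltW/lee0_abs ->] := leP 0%E (lebint (fun v => (f (cons_row x v))%:E)).
  apply: (lebint_le _ _ _ (fx x) (gx x)) => v.
  exact: le_trans (ler_norm _) (fg _).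
rewrite -mulN1e -lN; apply: (lebint_le _ _ _ fNx (gx x)) => v.
by rewrite mulN1r; apply: le_trans (ler_norm _) _; rewrite normrN.
Qed.

(** The factor of the first coordinate is constant for the inner integral and comes out of it. *)
Lemma lebint_prod {R : realType} n (h : 'I_n -> R -> R) (a : 'I_n -> R) :
  (forall i, lebesgue_measure.-integrable setT (fun x => (h i x)%:E)) ->
  (forall i, \int[lebesgue_measure]_x (h i x)%:E = (a i)%:E)%E ->
  mvintegrable (fun v : 'rV[R]_n => \prod_i h i (v 0 i)) /\
  lebint (fun v : 'rV[R]_n => (\prod_i h i (v 0 i))%:E) = (\prod_i a i)%:E.
Proof.
elim: n h a => [|n IHn] h a hi ha; first by rewrite /= !big_ord0.
have E x (v : 'rV[R]_n) : \prod_i h i (cons_row x v 0 i) =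
    h ord0 x * \prod_i h (lift ord0 i) (v 0 i).
  rewrite big_ord_recl cons_row0; congr (_ * _).
  by apply: eq_bigr => i _; rewrite cons_rowS.
have [pi pE] := IHn (fun i => h (lift ord0 i)) (fun i => a (lift ord0 i))
  (fun i => hi _) (fun i => ha _).
have LE x : lebint (fun v : 'rV[R]_n => (\prod_i h i (cons_row x v 0 i))%:E) =
    ((\prod_i a (lift ord0 i))%:E * (h ord0 x)%:E)%E.
  rewrite (eq_lebint _ _ _ (fun v => congr1 EFin (E x v))).
  by rewrite (mvintegrableZ n _ _ pi).2 pE muleC.
split; last first.
  rewrite lebintS; under eq_integral do rewrite LE.
  by rewrite integralZl// ha -EFinM mulrC -big_ord_recl.
split=> [x|].
  under eq_fun do rewrite E.
  exact: (mvintegrableZ n _ _ pi).1.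
by under eq_fun do rewrite LE; exact: integrableZl.
Qed.

(** * Moments of the one-dimensional normal density *)

Section one_dim.
Context {R : realType}.
Local Open Scope classical_set_scope.
Notation leb := (@lebesgue_measure R).

(** The fundamental theorem of calculus on growing intervals centred at [m] gives the boundary
    terms, which tend to 0. Dominated convergence with majorant [|f|] passes to the whole line. *)
Lemma integral_derive_eq0 (m : R) (F f : R -> R) :
  continuous f -> (forall x : R, is_derive x (1 : R) F (f x)) ->
  leb.-integrable setT (EFin \o f) ->
  (fun n : nat => F (m + n.+1%:R) - F (m - n.+1%:R)) @ \oo --> (0 : R) ->
  (\int[leb]_x (f x)%:E = 0)%E.
Proof.
move=> cf dF fi F0.
have dF' x : derivable F x 1 by exact: (@ex_derive _ _ _ _ _ _ _ (dF x)).
have cF : continuous F by move=> x; apply/differentiable_continuous/derivable1_diffP.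
(* The radius [n.+1] keeps the interval nondegenerate at [n = 0], as the fundamental theorem
   requires. *)
pose D n : set R := `[m - n.+1%:R, m + n.+1%:R].
have := @dominated_convergence _ _ _ leb setT measurableT
  (fun n => (EFin \o f) \_ (D n)) (EFin \o f) (fun x => `|f x|%:E).
case.
- move=> n; apply: (measurable_restrictT _ _).1; first exact: measurable_itv.
  by apply: measurable_funTS; case/integrableP: fi.
- exact: measurable_int fi.
- apply: aeW => x _; apply: cvg_near_cst.
  near=> n; rewrite patchE ifT// inE /D/= in_itv/=.
  have : `|x - m| < n.+1%:R.
    rewrite -natr1 ltr_wpDr//.
    by near: n; exact: nbhs_infty_gtr.
  by rewrite ltr_norml => /andP[? ?]; apply/andP; split; lra.
- exact: integrable_abse fi.
- apply: aeW => x n _; rewrite patchE; case: ifPn => // _.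
  by rewrite abse0 lee_fin.
move=> _ _ fcvg.
have FTC n : (\int[leb]_x ((EFin \o f) \_ (D n)) x =
    (F (m + n.+1%:R) - F (m - n.+1%:R))%:E)%E.
  rewrite -integral_mkcond (@continuous_FTC2 _ f F)//.
  - have : (0 : R) < n.+1%:R by rewrite ltr0n.
    lra.
  - exact: continuous_subspaceT.
  - split=> //.
  - by apply: cvg_at_right_filter; exact: cF.
  - by apply: cvg_at_left_filter; exact: cF.
  - by move=> x _; rewrite derive1E; apply: derive_val.
move: fcvg; rewrite (funext FTC) => fcvg.
apply: (cvg_unique _ fcvg); first exact: ereal_hausdorff.
by apply/fine_cvgP; split; [exact: nearW|exact: F0].
Unshelve. all: by end_near. Qed.

Variables (m sigma : R).
Hypothesis sigma0 : sigma != 0.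
Local Notation pdf := (normal_pdf m sigma).

Lemma is_derive_normal_pdf (x : R) :
  is_derive x (1 : R) pdf (- ((x - m) * pdf x) / sigma ^+ 2).
Proof.
have -> : pdf = normal_peak sigma \*:
    (expR \o ((- (sigma ^+ 2 *+ 2)^-1) \*: (id - cst m) ^+ 2)) :> (R -> R).
  rewrite normal_pdfE//; apply/funext => y; congr (_ * expR _).
  by rewrite mulNr mulrC -mulNr.
apply: is_derive_eq => /=.
rewrite !fctE /GRing.scale/=.
by field.
Qed.

(* [y <= exp y] absorbs the square into a density of doubled variance. *)
Lemma sqr_normal_pdf_le (x : R) : (x - m) ^+ 2 * pdf x <=
  4 * sigma ^+ 2 * normal_peak sigma / normal_peak (Num.sqrt 2 * sigma) *
  normal_pdf m (Num.sqrt 2 * sigma) x.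
Proof.
have t0 : Num.sqrt 2 * sigma != 0 by rewrite mulf_neq0// sqrtr_eq0 -ltNge.
have s2 : 0 < sigma ^+ 2 by rewrite exprn_even_gt0.
rewrite !normal_pdfE//.
have pt := normal_peak_gt0 t0.
rewrite mulrCA.
have E (a b c e : R) : e != 0 -> a * b / e * (e * c) = b * (a * c) by move=> ?; field.
rewrite E ?lt0r_neq0//.
rewrite ler_wpM2l ?normal_peak_ge0// /normal_fun exprMn sqr_sqrtr//.
set y := (x - m) ^+ 2.
have -> : - y / (sigma ^+ 2 *+ 2) = - y / (2 * sigma ^+ 2 *+ 2) + - y / (2 * sigma ^+ 2 *+ 2).
  by field.
rewrite expRD mulrA ler_wpM2r ?expR_ge0// mulNr expRN ler_pdivrMr ?expR_gt0//.
apply: (@le_trans _ _ (4 * sigma ^+ 2 * (y / (2 * sigma ^+ 2 *+ 2)))).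
  by rewrite le_eqVlt; apply/orP; left; apply/eqP; field.
apply: ler_wpM2l; first exact: mulr_ge0 (ltW s2).
by apply: le_trans (expR_ge1Dx _); rewrite lerDr.
Qed.

Lemma measurable_center_normal_pdf k :
  measurable_fun setT (fun x : R => (x - m) ^+ k * pdf x).
Proof.
apply: measurable_funM; last exact: measurable_normal_pdf.
by apply: measurable_funX; exact: measurable_funB.
Qed.

Lemma integrable_sqr_normal_pdf :
  leb.-integrable setT (fun x => ((x - m) ^+ 2 * pdf x)%:E).
Proof.
set K := 4 * sigma ^+ 2 * normal_peak sigma / normal_peak (Num.sqrt 2 * sigma).
apply: (@le_integrable _ _ _ leb _ measurableT _
  (fun x => K%:E * (normal_pdf m (Num.sqrt 2 * sigma) x)%:E)%E).
- by apply/measurable_EFinP; exact: measurable_center_normal_pdf.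
- move=> x _; rewrite -EFinM lee_fin ger0_norm.
    exact: le_trans (sqr_normal_pdf_le x) (ler_norm _).
  by rewrite mulr_ge0 ?sqr_ge0 ?normal_pdf_ge0.
- by apply: integrableZl => //; exact: integrable_normal_pdf.
Qed.

(** Follows from the second moment, since [|y| <= 1 + y^2]. *)
Lemma integrable_center_normal_pdf :
  leb.-integrable setT (fun x => ((x - m) * pdf x)%:E).
Proof.
apply: (@le_integrable _ _ _ leb _ measurableT _
  (fun x => (pdf x)%:E + ((x - m) ^+ 2 * pdf x)%:E)%E).
- apply/measurable_EFinP.
  by have := measurable_center_normal_pdf 1; under eq_fun do rewrite expr1.
- move=> x _; rewrite -EFinD lee_fin normrM (ger0_norm (normal_pdf_ge0 _ _ _)).
  apply: le_trans (ler_norm _).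
  have p0 := normal_pdf_ge0 m sigma x.
  rewrite -[X in _ <= X + _]mul1r -mulrDl ler_wpM2r// -real_normK ?num_real//.
  by have := normr_ge0 (x - m); nra.
- by apply: integrableD => //; [exact: integrable_normal_pdf|exact: integrable_sqr_normal_pdf].
Qed.

Lemma continuous_center_normal_pdf k : continuous (fun x : R => (x - m) ^+ k * pdf x).
Proof.
move=> x; apply: cvgM; last exact: continuous_normal_pdf.
apply: (cvg_comp (fun x : R => x - m) (fun x => x ^+ k)); last exact: exprn_continuous.
by apply: cvgB; [exact: cvg_id|exact: cvg_cst].
Qed.

(** The antiderivative [- sigma^2 pdf] is symmetric about [m], so the boundary terms cancel
    exactly. *)
Lemma integral_center_normal_pdf :
  (\int[leb]_x ((x - m) * pdf x)%:E = 0)%E.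
Proof.
pose F : R -> R := - (sigma ^+ 2) \*: pdf.
pose f (x : R) : R := (x - m) * pdf x.
apply: (@integral_derive_eq0 m F f).
- by have := continuous_center_normal_pdf 1; under eq_fun do rewrite expr1.
- move=> x; have := is_derive_normal_pdf x => ?.
  by rewrite /F; apply: is_derive_eq; rewrite /f /GRing.scale/=; field.
- exact: integrable_center_normal_pdf.
- apply: cvg_near_cst; apply: nearW => n.
  rewrite /F /= /GRing.scale/= !normal_pdfE// /normal_fun.
  by rewrite !(addrAC m _ (- m)) !subrr !add0r sqrrN subrr.
Qed.

(** Integration by parts: [(x - m)^2 pdf - sigma^2 pdf] is the derivative of
    [- sigma^2 (x - m) pdf], hence has integral 0, and [pdf] has total mass 1. *)
Lemma integral_sqr_normal_pdf :
  (\int[leb]_x ((x - m) ^+ 2 * pdf x)%:E = (sigma ^+ 2)%:E)%E.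
Proof.
pose f (x : R) : R := (x - m) ^+ 2 * pdf x - sigma ^+ 2 * pdf x.
have if1 := integrable_sqr_normal_pdf.
have if2 : leb.-integrable setT (fun x => (sigma ^+ 2)%:E * (pdf x)%:E)%E.
  by apply: integrableZl => //; exact: integrable_normal_pdf.
have : (\int[leb]_x (f x)%:E = 0)%E.
  pose F : R -> R := - (sigma ^+ 2) \*: ((id - cst m) * pdf).
  apply: (@integral_derive_eq0 m F f).
  - move=> x; apply: cvgB; first exact: continuous_center_normal_pdf.
    apply: cvgM; first exact: cvg_cst.
    exact: continuous_normal_pdf.
  - move=> x; have := is_derive_normal_pdf x => ?; rewrite /F.
    apply: is_derive_eq; rewrite !fctE /GRing.scale/= /f; by field.
  - have := integrableB measurableT if1 if2.
    by apply: eq_integrable => // x _; rewrite /f/= EFinB EFinM.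
  (* [K] bounds [(x - m)^2 pdf] everywhere: the wider density is at most its peak. The boundary
     term, [- 2 sigma^2 (n+1) pdf (m + n + 1)], is therefore at most [2 sigma^2 K / (n+1)] in
     size. *)
  - set K := 4 * sigma ^+ 2 * normal_peak sigma / normal_peak (Num.sqrt 2 * sigma) * normal_peak (Num.sqrt 2 * sigma).
    have t0 : Num.sqrt 2 * sigma != 0 by rewrite mulf_neq0// sqrtr_eq0 -ltNge.
    have lim0 : (fun n : nat => - (2 * sigma ^+ 2 * K) * n.+1%:R^-1) @ \oo --> (0 : R).
      rewrite -[X in _ --> X](mulr0 (- (2 * sigma ^+ 2 * K))).
      apply: cvgM; first exact: cvg_cst.
      exact: cvg_harmonic.
    have lim1 : (fun n : nat => (0 : R)) @ \oo --> (0 : R) by exact: cvg_cst.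
    apply: (squeeze_cvgr _ lim0 lim1); apply: nearW => n.
    have n0 : (0 : R) < n.+1%:R by rewrite ltr0n.
    have sym : pdf (m - n.+1%:R) = pdf (m + n.+1%:R).
      rewrite !normal_pdfE// /normal_pdf /normal_fun.
      by rewrite !(addrAC m _ (- m)) !subrr !add0r sqrrN.
    rewrite /F !fctE /GRing.scale/= sym !(addrAC m _ (- m)) !subrr !add0r.
    set p := pdf _.
    have p0 : 0 <= p by exact: normal_pdf_ge0.
    have s2 : 0 <= sigma ^+ 2 by exact: sqr_ge0.
    have : n.+1%:R * p <= K / n.+1%:R.
      rewrite ler_pdivlMr// mulrAC -expr2.
      have := sqr_normal_pdf_le (m + n.+1%:R).
      rewrite (addrAC m _ (- m)) subrr add0r => /le_trans; apply.
      apply: ler_wpM2l; last exact: normal_pdf_ub.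
      apply: divr_ge0; last exact: normal_peak_ge0.
      by apply: mulr_ge0; [exact: mulr_ge0|exact: normal_peak_ge0].
    rewrite (_ : _ - _ = - (2 * sigma ^+ 2) * (n.+1%:R * p)); last first.
      by rewrite /GRing.scale/=; ring.
    move=> npK; have s22 : 0 <= 2 * sigma ^+ 2 by exact: mulr_ge0.
    rewrite !mulNr oppr_le0 lerN2 -(mulrA (2 * sigma ^+ 2) K); apply/andP; split.
      exact: ler_wpM2l.
    by apply: mulr_ge0 => //; apply: mulr_ge0 => //; exact: ltW.
rewrite (_ : (fun x => (f x)%:E) = (fun x => ((x - m) ^+ 2 * pdf x)%:E - (sigma ^+ 2)%:E * (pdf x)%:E)%E); last first.
  by apply/funext => x; rewrite /f EFinB EFinM.
rewrite integralB// integralZl//; last exact: integrable_normal_pdf.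
rewrite integral_normal_pdf mule1.
move: (integrable_fin_num measurableT if1).
by case: integral => // a _ [/eqP]; rewrite subr_eq0 => /eqP ->.
Qed.

End one_dim.

(** * Expectations under a product of normal densities *)

Section expectation.
Context {R : realType}.

(** The entries of [sigma] are standard deviations, not variances. *)
Definition normal_density {N} (m sigma v : 'rV[R]_N) : R :=
  \prod_i normal_pdf (m 0 i) (sigma 0 i) (v 0 i).

(** Integrability and a real value are carried together, so that linear combinations can be formed
    without treating infinite values. *)
Definition has_expectation {N} (m sigma : 'rV[R]_N) (f : 'rV[R]_N -> R) (a : R) :=
  mvintegrable (fun v => normal_density m sigma v * f v) /\
  lebint (fun v => (normal_density m sigma v * f v)%:E) = a%:E.

Lemma normal_moment (m s : R) (k : nat) : s != 0 -> (k <= 2)%N ->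
  lebesgue_measure.-integrable setT (fun x => (normal_pdf m s x * (x - m) ^+ k)%:E) /\
  (\int[lebesgue_measure]_x (normal_pdf m s x * (x - m) ^+ k)%:E =
   ([:: 1; 0; s ^+ 2]`_k)%:E)%E.
Proof.
move=> s0; case: k => [|[|[|//]]] _.
- have -> : (fun x : R => (normal_pdf m s x * (x - m) ^+ 0)%:E) =
      (fun x => (normal_pdf m s x)%:E).
    by apply/funext => x; rewrite expr0 mulr1.
  by split; [exact: integrable_normal_pdf|exact: integral_normal_pdf].
- have -> : (fun x : R => (normal_pdf m s x * (x - m) ^+ 1)%:E) =
      (fun x => ((x - m) * normal_pdf m s x)%:E).
    by apply/funext => x; rewrite expr1 mulrC.
  by split; [exact: integrable_center_normal_pdf|exact: integral_center_normal_pdf].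
- have -> : (fun x : R => (normal_pdf m s x * (x - m) ^+ 2)%:E) =
      (fun x => ((x - m) ^+ 2 * normal_pdf m s x)%:E).
    by apply/funext => x; rewrite mulrC.
  by split; [exact: integrable_sqr_normal_pdf|exact: integral_sqr_normal_pdf].
Qed.

Context {N : nat} {m sigma : 'rV[R]_N}.
Hypothesis sigma0 : forall i, sigma 0 i != 0.
Local Notation hasE := (has_expectation m sigma).

Lemma eq_has_expectation {f g : 'rV[R]_N -> R} {a : R} :
  f =1 g -> hasE f a -> hasE g a.
Proof. by move=> /funext ->. Qed.

Lemma has_expectationD {f g : 'rV[R]_N -> R} {a b : R} :
  hasE f a -> hasE g b -> hasE (fun v => f v + g v) (a + b).
Proof.
move=> [fi fE] [gi gE].
rewrite /has_expectation.
have -> : (fun v => normal_density m sigma v * (f v + g v)) =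
    (fun v => normal_density m sigma v * f v + normal_density m sigma v * g v).
  by apply/funext => v; rewrite mulrDr.
have [? fgE] := mvintegrableD _ _ _ fi gi; split=> //.
under eq_lebint do rewrite mulrDr.
by rewrite fgE fE gE.
Qed.

Lemma has_expectationZ (k : R) {f : 'rV[R]_N -> R} {a : R} :
  hasE f a -> hasE (fun v => k * f v) (k * a).
Proof.
move=> [fi fE]; rewrite /has_expectation.
have -> : (fun v => normal_density m sigma v * (k * f v)) =
    (fun v => k * (normal_density m sigma v * f v)).
  by apply/funext => v; rewrite mulrCA.
have [? kE] := mvintegrableZ _ k _ fi; split=> //.
under eq_lebint do rewrite mulrCA.
by rewrite kE fE.
Qed.

(** The exponent is chosen per coordinate, so that total mass, means and covariances are all
    instances. *)
Lemma has_expectation_prod (k : 'I_N -> nat) : (forall i, (k i <= 2)%N) ->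
  hasE (fun v => \prod_i (v 0 i - m 0 i) ^+ k i)
    (\prod_i [:: 1; 0; sigma 0 i ^+ 2]`_(k i)).
Proof.
move=> k2.
have [i1 i2] := lebint_prod _
  (fun i x => normal_pdf (m 0 i) (sigma 0 i) x * (x - m 0 i) ^+ k i) _
  (fun i => (normal_moment (m 0 i) (sigma 0 i) (k i) (sigma0 i) (k2 i)).1)
  (fun i => (normal_moment (m 0 i) (sigma 0 i) (k i) (sigma0 i) (k2 i)).2).
rewrite /has_expectation -i2.
by split; [move: i1; congr mvintegrable|congr lebint];
  apply/funext => v; rewrite /normal_density -big_split.
Qed.

Lemma has_expectation1 : hasE (fun=> 1) 1.
Proof.
have := has_expectation_prod (fun=> 0%N) (fun=> isT).
rewrite [X in hasE _ X]big1//.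
by apply: eq_has_expectation => v; rewrite big1.
Qed.

Lemma has_expectation_cst (a : R) : hasE (fun=> a) a.
Proof.
by have := has_expectationZ a has_expectation1; rewrite mulr1.
Qed.

Lemma has_expectation_sum n (f : 'I_n -> 'rV[R]_N -> R) (a : 'I_n -> R) :
  (forall i, hasE (f i) (a i)) -> hasE (fun v => \sum_i f i v) (\sum_i a i).
Proof.
elim: n f a => [|n IHn] f a fa.
  rewrite big_ord0; apply: eq_has_expectation (has_expectation_cst 0) => v.
  by rewrite big_ord0.
rewrite big_ord_recl.
apply: eq_has_expectation (has_expectationD (fa ord0)
  (IHn _ _ (fun i => fa (lift ord0 i)))) => v.
by rewrite big_ord_recl.
Qed.

Let prod_pred1 (x : 'I_N -> R) i : \prod_l x l ^+ (l == i) = x i.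
Proof.
rewrite (bigD1 i)//= eqxx expr1 big1 ?mulr1// => j /negPf ->.
by rewrite expr0.
Qed.

Lemma has_expectation_center i : hasE (fun v => v 0 i - m 0 i) 0.
Proof.
have := has_expectation_prod (fun l => l == i) (fun l => leqW (leq_b1 _)).
rewrite [X in hasE _ X](bigD1 i)//= eqxx mul0r.
by apply: eq_has_expectation => v; rewrite prod_pred1.
Qed.

Lemma has_expectation_cov i j :
  hasE (fun v => (v 0 i - m 0 i) * (v 0 j - m 0 j)) ((sigma 0 i ^+ 2) *+ (i == j)).
Proof.
(* The exponent at [l] counts the occurrences of [l] among [i] and [j]: it is 2 at [i] when [i = j],
   which gives the variance, and otherwise 1, whose moment 0 kills the product. *)
have := has_expectation_prod (fun l => (l == i) + (l == j))%N
  (fun l => leq_add (leq_b1 _) (leq_b1 _)).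
rewrite [X in hasE _ X](bigD1 i)//= eqxx /=.
have -> : [:: 1; 0; sigma 0 i ^+ 2]`_(1 + (i == j)) *
    \prod_(l < N | l != i) [:: 1; 0; sigma 0 l ^+ 2]`_((l == i) + (l == j)) =
    sigma 0 i ^+ 2 *+ (i == j).
  case: eqP => [<-|_] /=; last by rewrite mul0r.
  by rewrite big1 ?mulr1// => l /negPf ->.
apply: eq_has_expectation => v; under eq_bigr do rewrite exprD.
by rewrite big_split !prod_pred1.
Qed.

Lemma has_expectation_linear (w : 'cV[R]_N) : hasE (fun v => ((v - m) *m w) 0 0) 0.
Proof.
have := has_expectation_sum _ _ _
  (fun i => has_expectationZ (w i 0) (has_expectation_center i)).
rewrite big1 => [|i _]; last by rewrite mulr0.
apply: eq_has_expectation => v; rewrite mxE.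
by apply: eq_bigr => i _; rewrite !mxE mulrC.
Qed.

Lemma has_expectation_quadratic (M : 'M[R]_N) :
  hasE (fun v => qform (v - m) M)
    (\tr (M *m diag_mx (\row_i sigma 0 i ^+ 2))).
Proof.
have := has_expectation_sum _ _ _ (fun j => has_expectation_sum _ _ _
  (fun i => has_expectationZ (M i j) (has_expectation_cov i j))).
rewrite (_ : \sum_j _ = \tr (M *m diag_mx (\row_i sigma 0 i ^+ 2))); last first.
  apply: eq_bigr => j _; rewrite mul_mx_diag !mxE (bigD1 j)//= eqxx mulr1n.
  by rewrite big1 ?addr0// => i /negPf ->; rewrite mulr0n mulr0.
apply: eq_has_expectation => v; rewrite /qform mxE.
apply: eq_bigr => j _; rewrite !mxE mulr_suml.
by apply: eq_bigr => i _; rewrite !mxE; ring.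
Qed.

(** Expand around the mean, [v L + b = (v - m) L + c]: the quadratic part gives the trace, by
    cyclicity, both cross terms have expectation 0, and [qform c A] remains. *)
Lemma has_expectation_qform d (L : 'M[R]_(N, d)) (b : 'rV[R]_d) (A : 'M[R]_d) :
  hasE (fun v => qform (v *m L + b) A)
    (qform (m *m L + b) A + \tr (A *m (L^T *m diag_mx (\row_i sigma 0 i ^+ 2) *m L))).
Proof.
set c := m *m L + b.
have := has_expectationD (has_expectationD (has_expectation_quadratic (L *m A *m L^T))
  (has_expectation_linear (L *m A *m c^T)))
  (has_expectationD (has_expectation_linear (c *m A *m L^T)^T) (has_expectation_cst (qform c A))).
rewrite addr0 add0r addrC.
rewrite (_ : \tr (L *m A *m _ *m _) =
  \tr (A *m (L^T *m diag_mx (\row_i sigma 0 i ^+ 2) *m L))); last first.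
  by rewrite -!mulmxA mxtrace_mulC !mulmxA.
apply: eq_has_expectation => v.
have -> : v *m L + b = (v - m) *m L + c by rewrite mulmxBl addrA subrK.
set u := v - m.
have -> : (u *m (c *m A *m L^T)^T) 0 0 = (c *m A *m (u *m L)^T) 0 0.
  (* A 1 by 1 matrix equals its transpose, which turns this cross term into a linear form in [u]. *)
  have T (X : 'M[R]_1) : X 0 0 = X^T 0 0 by rewrite [RHS]mxE.
  by rewrite T trmx_mul trmxK trmx_mul !mulmxA.
rewrite /qform; clearbody u c; rewrite raddfD/= !mulmxDl !mulmxDr trmx_mul !mulmxA.
have D (X Y : 'M[R]_1) : (X + Y) 0 0 = X 0 0 + Y 0 0 by rewrite mxE.
by rewrite !D; ring.
Qed.

(** Gives a finite expectation without computing it, as needed for the log of the mixture. *)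
Lemma has_expectation_dominated (f g : 'rV[R]_N -> R) (b : R) :
  mvmeasurable f -> (forall v, `|f v| <= g v) -> hasE g b ->
  exists a, hasE f a.
Proof.
move=> mf fg [gi _].
have p0 v : 0 <= normal_density m sigma v.
  by apply: prodr_ge0 => i _; exact: normal_pdf_ge0.
have fi : mvintegrable (fun v => normal_density m sigma v * f v).
  apply: mvintegrable_dominated gi.
  - move=> d T c mc; apply: measurable_funM; last exact: mf.
    apply: measurable_prod => i _.
    by apply: (measurableT_comp (measurable_normal_pdf _ _)).
  - by move=> v; rewrite normrM ger0_norm// ler_wpM2l.
exists (fine (lebint (fun v => (normal_density m sigma v * f v)%:E))).
by split=> //; rewrite fineK// lebint_fin_num.
Qed.

End expectation.

(** * Positive definite matrices and Gaussian densities *)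

Section posdef.
Context {R : realType} {n : nat}.
Implicit Types S T : 'M[R]_n.

Lemma qformD (v : 'rV[R]_n) S T : qform v (S + T) = qform v S + qform v T.
Proof. by rewrite /qform mulmxDr mulmxDl mxE. Qed.

Lemma qformZ (v : 'rV[R]_n) a S : qform v (a *: S) = a * qform v S.
Proof. by rewrite /qform -scalemxAr -scalemxAl mxE. Qed.

Lemma qformN (v : 'rV[R]_n) S : qform (- v) S = qform v S.
Proof. by rewrite /qform raddfN/= mulNmx mulNmx mulmxN opprK. Qed.

Lemma qform1 (v : 'rV[R]_n) : qform v 1%:M = \sum_i v 0 i ^+ 2.
Proof.
by rewrite /qform mulmx1 mxE; apply: eq_bigr => i _; rewrite mxE expr2.
Qed.

Lemma sym_posdef_ge0 S (v : 'rV[R]_n) : sym_posdef S -> 0 <= qform v S.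
Proof.
move=> [_ S0]; have [->|/S0/ltW//] := eqVneq v 0.
by rewrite /qform mul0mx mul0mx mxE.
Qed.

Lemma sym_posdefD S T : sym_posdef S -> sym_posdef T -> sym_posdef (S + T).
Proof.
move=> [St S0] [Tt T0]; split; first by rewrite linearD /= St Tt.
by move=> v v0; rewrite qformD addr_gt0 ?S0 ?T0.
Qed.

Lemma sym_posdefZ a S : 0 < a -> sym_posdef S -> sym_posdef (a *: S).
Proof.
move=> a0 [St S0]; split; first by rewrite linearZ /= St.
by move=> v v0; rewrite qformZ mulr_gt0 ?S0.
Qed.

Lemma sym_posdef1 : sym_posdef (1%:M : 'M[R]_n).
Proof.
split=> [|v v0]; first exact: trmx1.
rewrite qform1 lt_neqAle eq_sym sumr_ge0 ?andbT; last by move=> i _; exact: sqr_ge0.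
apply: contra v0 => /eqP/psumr_eq0P v0; apply/eqP/rowP => i; rewrite mxE.
by apply/eqP; rewrite -sqrf_eq0; apply/eqP/v0 => // j _; exact: sqr_ge0.
Qed.

Lemma sym_posdef_det_neq0 S : sym_posdef S -> \det S != 0.
Proof.
move=> [_ S0]; apply/negP => /det0P[v v0 vS].
by have := S0 v v0; rewrite /qform vS mul0mx mxE ltxx.
Qed.

(* The segment from the identity to [S] stays positive definite, so the
   determinant cannot vanish, hence cannot change sign, along it. *)
Lemma sym_posdef_det_gt0 S : sym_posdef S -> 0 < \det S.
Proof.
move=> pS; rewrite lt_neqAle eq_sym sym_posdef_det_neq0//= leNgt; apply/negP => S0.
(* The segment is written as a matrix over polynomials, so that its determinant is a polynomial in
   the parameter and has the intermediate value property. *)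
pose M : 'M[{poly R}]_n := map_mx polyC 1%:M + 'X *: map_mx polyC (S - 1%:M).
have ME t : (\det M).[t] = \det (1%:M + t *: (S - 1%:M)).
  rewrite -[LHS]/(horner_eval t (\det M)) -det_map_mx; congr (\det _).
  by apply/matrixP => i j; rewrite !mxE/= /horner_eval !hornerE.
(* The sign is flipped so that the values go up, from -1 at the identity to [- \det S] at [S]. *)
have [|t /andP[t0 t1]] := @poly_ivt R (- \det M) 0 1 ler01.
  rewrite !hornerN !ME scale0r addr0 det1 scale1r addrC subrK.
  by rewrite oppr_le0 ler01 oppr_ge0 ltW.
rewrite rootE hornerN oppr_eq0 ME; apply/negP.
have -> : 1%:M + t *: (S - 1%:M) = t *: S + (1 - t) *: 1%:M.
  by rewrite scalerBr scalerBl scale1r addrCA.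
apply: sym_posdef_det_neq0.
have [->|tn0] := eqVneq t 0.
  by rewrite scale0r add0r subr0 scale1r; exact: sym_posdef1.
have [->|tn1] := eqVneq t 1.
  by rewrite subrr scale0r addr0 scale1r.
apply: sym_posdefD; apply: sym_posdefZ => //; last exact: sym_posdef1.
- by rewrite lt_neqAle eq_sym tn0.
- by rewrite subr_gt0 lt_neqAle tn1.
Qed.

Lemma sym_posdef_unit S : sym_posdef S -> S \in unitmx.
Proof. by move=> /sym_posdef_det_neq0; rewrite unitmxE unitfE. Qed.

(** With [u = v S^-1], symmetry gives [v S^-1 v^T = u S u^T]. *)
Lemma qform_invmx_ge0 S (v : 'rV[R]_n) : sym_posdef S -> 0 <= qform v (invmx S).
Proof.
move=> pS; have uS := sym_posdef_unit S pS.
have := sym_posdef_ge0 S (v *m invmx S) pS.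
by rewrite /qform mulmxKV// trmx_mul trmx_inv pS.1 mulmxA.
Qed.

Lemma det_scale_gt0 S a : 0 < a -> sym_posdef S -> 0 < \det (a *: S).
Proof. by move=> a0 pS; exact/sym_posdef_det_gt0/sym_posdefZ. Qed.

Lemma ln_gauss (v m : 'rV[R]_n) S : sym_posdef S ->
  ln (gauss v m S) = - (1/2) * (qform (v - m) (invmx S) + n%:R * ln (2 * pi) + ln (\det S)).
Proof.
move=> pS; have pi2 : 0 < 2 * pi :> R by rewrite mulr_gt0// pi_gt0.
have d0 := det_scale_gt0 S _ pi2 pS.
have s0 : 0 < Num.sqrt (\det ((2 * pi) *: S)) by rewrite sqrtr_gt0.
rewrite /gauss ln_div ?posrE ?expR_gt0// expRK.
have E1 : ln (\det ((2 * pi) *: S)) = ln (Num.sqrt (\det ((2 * pi) *: S))) *+ 2.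
  by rewrite -lnXn// sqr_sqrtr// ltW.
have E2 : ln (\det ((2 * pi) *: S)) = n%:R * ln (2 * pi) + ln (\det S).
  have pn : (2 * pi) ^+ n \is @Num.pos R by rewrite posrE exprn_gt0.
  have pd : \det S \is Num.pos by rewrite posrE sym_posdef_det_gt0.
  by rewrite detZ (lnM pn pd) lnXn// [in RHS]mulr_natl.
have -> : ln (Num.sqrt (\det ((2 * pi) *: S))) = (n%:R * ln (2 * pi) + ln (\det S)) / 2.
  by rewrite -E2 E1; field.
by field.
Qed.

Lemma gauss_gt0 (v m : 'rV[R]_n) S : sym_posdef S -> 0 < gauss v m S.
Proof.
move=> pS; rewrite divr_gt0 ?expR_gt0// sqrtr_gt0 det_scale_gt0//.
by rewrite mulr_gt0// pi_gt0.
Qed.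

Lemma gauss_le (v m : 'rV[R]_n) S : sym_posdef S ->
  gauss v m S <= (Num.sqrt (\det ((2 * pi) *: S)))^-1.
Proof.
move=> pS; rewrite /gauss ler_piMl ?invr_ge0// -[leRHS]expR0 ler_expR mulNr oppr_le0.
by rewrite mulr_ge0// qform_invmx_ge0.
Qed.

Lemma measurable_qform d (T : measurableType d) (z : T -> 'rV[R]_n) S :
  (forall i, measurable_fun setT (fun t => z t 0 i)) ->
  measurable_fun setT (fun t => qform (z t) S).
Proof.
move=> mz.
have -> : (fun t => qform (z t) S) = (fun t => \sum_j (\sum_i z t 0 i * S i j) * z t 0 j).
  apply/funext => t; rewrite /qform mxE; apply: eq_bigr => j _.
  by rewrite !mxE.
apply: measurable_sum => j; apply: measurable_funM => //.
by apply: measurable_sum => i; apply: measurable_funM.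
Qed.

Lemma measurable_gauss d (T : measurableType d) (z : T -> 'rV[R]_n) (m : 'rV[R]_n) S :
  (forall i, measurable_fun setT (fun t => z t 0 i)) ->
  measurable_fun setT (fun t => gauss (z t) m S).
Proof.
move=> mz; apply: measurable_funM => //; apply: measurableT_comp => //.
apply: measurable_funM => //; apply: measurable_qform => i.
by under eq_fun do rewrite !mxE; apply: measurable_funB.
Qed.

End posdef.

(** * Diagonal covariances *)

Section diag.
Context {R : realType} {n : nat}.
Implicit Types S : 'M[R]_n.

Lemma diag_posdefE S : diag_posdef S -> S = diag_mx (\row_i S i i).
Proof.
move=> [/is_diag_mxP dS _]; apply/matrixP => i j; rewrite !mxE.
by case: eqVneq => [->|ij]; rewrite ?mulr1n// mulr0n dS.
Qed.

Lemma qform_diag (v s : 'rV[R]_n) : qform v (diag_mx s) = \sum_i v 0 i ^+ 2 * s 0 i.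
Proof.
rewrite /qform mul_mx_diag mxE; apply: eq_bigr => i _; rewrite !mxE; ring.
Qed.

Lemma diag_posdef_sym S : diag_posdef S -> sym_posdef S.
Proof.
move=> dS; have [_ S0] := dS; rewrite (diag_posdefE S dS); split=> [|v v0].
  exact: tr_diag_mx.
rewrite qform_diag lt_neqAle eq_sym sumr_ge0 ?andbT; last first.
  by move=> i _; rewrite mxE mulr_ge0 ?sqr_ge0 ?ltW.
have t0 i : 0 <= v 0 i ^+ 2 * (\row_k S k k) 0 i by rewrite mxE mulr_ge0 ?sqr_ge0 ?ltW.
apply: contra v0 => /eqP/(psumr_eq0P (fun i _ => t0 i)) vS; apply/eqP/rowP => i.
have /eqP := vS i isT; rewrite !mxE mulf_eq0 (gt_eqF (S0 i)) orbF sqrf_eq0.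
by move/eqP.
Qed.

Lemma invmx_diag_posdef S : diag_posdef S -> invmx S = diag_mx (\row_i (S i i)^-1).
Proof.
move=> dS; have uS := sym_posdef_unit S (diag_posdef_sym S dS).
apply: (can_inj (mulKmx uS)); rewrite mulmxV//.
have : diag_mx (\row_i S i i) *m diag_mx (\row_i (S i i)^-1) = 1%:M.
  rewrite mulmx_diag -diag_const_mx; congr diag_mx.
  by apply/rowP => i; rewrite !mxE divff// gt_eqF// dS.2.
by rewrite -diag_posdefE.
Qed.

Lemma sqrtr_prod (I : finType) (F : I -> R) : (forall i, 0 <= F i) ->
  Num.sqrt (\prod_i F i) = \prod_i Num.sqrt (F i).
Proof.
by move=> F0; elim/big_rec2: _ => [|i y x _ <-]; rewrite ?sqrtr1 ?sqrtrM.
Qed.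

(** For a diagonal covariance the quadratic form is a sum and the determinant a product over the
    coordinates, so the density factors. *)
Lemma gauss_diag (v m : 'rV[R]_n) S : diag_posdef S ->
  gauss v m S = normal_density m (\row_i Num.sqrt (S i i)) v.
Proof.
move=> dS; rewrite /gauss invmx_diag_posdef// qform_diag mulr_sumr expR_sum.
have -> : \det ((2 * pi) *: S) = \prod_i (2 * pi * S i i).
  rewrite big_split /= prodr_const card_ord detZ [in LHS](diag_posdefE S dS) det_diag.
  by congr (_ * _); apply: eq_bigr => i _; rewrite mxE.
have p0 i : 0 < 2 * pi * S i i by rewrite !mulr_gt0// ?pi_gt0// dS.2.
rewrite sqrtr_prod => [|i]; last exact: ltW.
rewrite -prodfV -big_split/=; apply: eq_bigr => i _.
have s0 : Num.sqrt (S i i) != 0 by rewrite gt_eqF// sqrtr_gt0 dS.2.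
rewrite !mxE normal_pdfE// /normal_peak /normal_fun sqr_sqrtr ?ltW ?dS.2//.
rewrite mulrC; congr ((Num.sqrt _)^-1 * expR _); first by ring.
by field; rewrite gt_eqF// dS.2.
Qed.
End diag.

(** * Bounds on the log of the mixture *)

Section mixture_bounds.
Context {R : realType} {d C : nat} {w : 'I_C -> R}.
Context {mu : 'I_C -> 'rV[R]_d} {Sig : 'I_C -> 'M[R]_d} {Saug : 'M[R]_d}.
Hypotheses (hSaug : sym_posdef Saug) (hSig : forall c, sym_posdef (Sig c)).
Hypotheses (hw : forall c, 0 <= w c <= 1) (hw1 : \sum_(c < C) w c = 1).
Implicit Types z : 'rV[R]_d.
Local Notation S c := (Sig c + (1/2) *: Saug).
Local Notation mix := (mixture w mu Sig Saug).

Let posS c : sym_posdef (S c).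
Proof. by apply: sym_posdefD => //; apply: sym_posdefZ => //; rewrite divr_gt0. Qed.

Let weight_gt0 : exists c, 0 < w c.
Proof.
case: (pickP (fun c => 0 < w c)) => [c wc|w0]; first by exists c.
move: hw1; rewrite big1 => [/esym/eqP|c _]; first by rewrite oner_eq0.
by apply/eqP; have := w0 c; have /andP[wc _] := hw c; rewrite lt_neqAle wc andbT eq_sym => /negbFE.
Qed.

Let mixture_ge c z z' :
  w c * gauss ((1/2) *: (z + z')) (mu c) (S c) <= mix z z'.
Proof.
rewrite /mixture (bigD1 c)//= lerDl sumr_ge0// => i _.
by have /andP[wi _] := hw i; rewrite mulr_ge0// ltW// gauss_gt0.
Qed.

Lemma mixture_gt0 z z' : 0 < mix z z'.
Proof.
have [c wc] := weight_gt0.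
by apply: lt_le_trans (mixture_ge c z z'); rewrite mulr_gt0// gauss_gt0.
Qed.

Let mixture_le z z' :
  mix z z' <= \sum_c (Num.sqrt (\det ((2 * pi) *: S c)))^-1.
Proof.
apply: ler_sum => c _; have /andP[w0 w1] := hw c.
apply: le_trans (gauss_le ((1/2) *: (z + z')) (mu c) _ (posS c)).
by rewrite ler_piMl// ltW// gauss_gt0.
Qed.

Lemma normr_ln_mixture_le : exists c B, forall z z',
  `|ln (mix z z')| <=
  B + 1/2 * qform ((1/2) *: (z + z') - mu c) (invmx (S c)).
Proof.
have [c wc] := weight_gt0.
pose U := \sum_c (Num.sqrt (\det ((2 * pi) *: S c)))^-1.
pose k := d%:R * ln (2 * pi) + ln (\det (S c)).
(* [|ln U|] serves the upper bound. The other two terms serve the lower bound: [k] collects the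
   normalising terms in the log density of the component [c], whose weight is positive. *)
exists c, (`|ln U| + `|ln (w c)| + 1/2 * `|k|) => z z'.
have m0 := mixture_gt0 z z'.
have U0 : 0 < U := lt_le_trans m0 (mixture_le z z').
set y := (1/2) *: (z + z').
have g0 : 0 < gauss y (mu c) (S c) by rewrite gauss_gt0.
have := qform_invmx_ge0 _ (y - mu c) (posS c).
have : ln (mix z z') <= ln U by rewrite ler_ln ?posrE// mixture_le.
have : ln (w c) + ln (gauss y (mu c) (S c)) <= ln (mix z z').
  rewrite -lnM ?posrE// ler_ln ?posrE//; last exact: mulr_gt0.
  exact: mixture_ge.
rewrite ln_gauss// -(addrA (qform _ _)) -/k.
have := ler_norm (ln U); have := normr_ge0 (ln U).
have := ler_norm (- ln (w c)); rewrite normrN; have := normr_ge0 (ln (w c)).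
have := ler_norm k; have := normr_ge0 k.
move=> *; rewrite ler_norml; apply/andP; split; lra.
Qed.

Lemma measurable_mixture e (T : measurableType e) (z z' : T -> 'rV[R]_d) :
  (forall i, measurable_fun setT (fun t => z t 0 i)) ->
  (forall i, measurable_fun setT (fun t => z' t 0 i)) ->
  measurable_fun setT (fun t => mix (z t) (z' t)).
Proof.
move=> mz mz'; apply: measurable_sum => c; apply: measurable_funM => //.
apply: measurable_gauss => i; under eq_fun do rewrite !mxE.
by apply: measurable_funM => //; exact: measurable_funD.
Qed.

End mixture_bounds.

(** * Posterior expectations and the Kullback-Leibler term *)

Section posterior_expectation.
Context {R : realType} {d : nat} {mx mx' : 'rV[R]_d} {Sx Sx' : 'M[R]_d}.
Hypotheses (hSx : diag_posdef Sx) (hSx' : diag_posdef Sx').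

Definition posterior_mean : 'rV[R]_(d + d) := row_mx mx mx'.
Definition posterior_std : 'rV[R]_(d + d) :=
  row_mx (\row_i Num.sqrt (Sx i i)) (\row_i Num.sqrt (Sx' i i)).
Local Notation hasE := (has_expectation posterior_mean posterior_std).

Lemma posterior_std_neq0 i : posterior_std 0 i != 0.
Proof.
rewrite mxE; case: fintype.split => j; rewrite mxE gt_eqF// sqrtr_gt0.
  exact: hSx.2.
exact: hSx'.2.
Qed.

Lemma diag_posterior_var :
  diag_mx (\row_i posterior_std 0 i ^+ 2) = block_mx Sx 0 0 Sx'.
Proof.
rewrite [in RHS](diag_posdefE Sx)// [in RHS](diag_posdefE Sx')// -diag_mx_row.
congr diag_mx; apply/rowP => i; rewrite !mxE.
by case: fintype.split => j; rewrite !mxE sqr_sqrtr// ltW// ?hSx.2 ?hSx'.2.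
Qed.

Lemma qpost_density (v : 'rV[R]_(d + d)) :
  qpost mx mx' Sx Sx' (lsubmx v) (rsubmx v) =
  normal_density posterior_mean posterior_std v.
Proof.
rewrite /qpost !gauss_diag// /normal_density big_split_ord/=.
by congr (_ * _); apply: eq_bigr => i _;
  rewrite /posterior_mean /posterior_std ?row_mxEl ?row_mxEr !mxE.
Qed.

Lemma EqE (f : 'rV[R]_d -> 'rV[R]_d -> R) (a : R) :
  hasE (fun v => f (lsubmx v) (rsubmx v)) a -> Eq mx mx' Sx Sx' f = a%:E.
Proof.
move=> [_ fE]; rewrite /Eq lebint_row_mx -fE; apply: eq_lebint => v.
by rewrite qpost_density.
Qed.

(** The combination is the image of the concatenated vector under a linear map, and the
    block-diagonal posterior covariance turns into [a^2 Sx + b^2 Sx']. Each quadratic form in the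
    two log densities and in the mixture bound is an instance. *)
Lemma has_expectation_qform_comb (a b : R) (c : 'rV[R]_d) (A : 'M[R]_d) :
  hasE (fun v => qform (a *: lsubmx v + b *: rsubmx v + c) A)
    (qform (a *: mx + b *: mx' + c) A + \tr (A *m (a ^+ 2 *: Sx + b ^+ 2 *: Sx'))).
Proof.
have := has_expectation_qform (m := posterior_mean) posterior_std_neq0 _ (col_mx a%:M b%:M) c A.
have LE (v : 'rV[R]_(d + d)) :
    v *m col_mx a%:M b%:M = a *: lsubmx v + b *: rsubmx v.
  by rewrite -{1}(hsubmxK v) mul_row_col !mul_mx_scalar.
rewrite LE row_mxKl row_mxKr diag_posterior_var tr_col_mx !tr_scalar_mx.
rewrite mul_row_block !mulmx0 addr0 add0r mul_row_col.
rewrite !mul_scalar_mx !mul_mx_scalar !scalerA -!expr2.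
by apply: eq_has_expectation => v; rewrite LE.
Qed.

Lemma has_expectation_ln_mixture C (w : 'I_C -> R) (mu : 'I_C -> 'rV[R]_d)
    (Sig : 'I_C -> 'M[R]_d) (Saug : 'M[R]_d) :
  sym_posdef Saug -> (forall c, sym_posdef (Sig c)) ->
  (forall c, 0 <= w c <= 1) -> \sum_(c < C) w c = 1 ->
  exists a, hasE (fun v => ln (mixture w mu Sig Saug (lsubmx v) (rsubmx v))) a.
Proof.
move=> hSaug hSig hw hw1.
have [c [B mixB]] := normr_ln_mixture_le hSaug hSig hw hw1 (mu := mu).
set A := invmx _ in mixB.
have hB := has_expectation_cst (m := posterior_mean) posterior_std_neq0 B.
have hQ := has_expectation_qform_comb (1/2) (1/2) (- mu c) A.
apply: has_expectation_dominated (has_expectationD hB (has_expectationZ (1/2) hQ)).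
- move=> e T v mv; apply: (measurableT_comp (@measurable_ln R)).
  by apply: measurable_mixture => i; under eq_fun do rewrite mxE; exact: mv.
- by move=> v; have := mixB (lsubmx v) (rsubmx v); rewrite scalerDr.
Qed.

Lemma has_expectation_ln_ratio C (w : 'I_C -> R) (mu : 'I_C -> 'rV[R]_d)
    (Sig : 'I_C -> 'M[R]_d) (Saug : 'M[R]_d) (a : R) :
  sym_posdef Saug -> (forall c, sym_posdef (Sig c)) ->
  (forall c, 0 <= w c <= 1) -> \sum_(c < C) w c = 1 ->
  hasE (fun v => ln (mixture w mu Sig Saug (lsubmx v) (rsubmx v))) a ->
  hasE (fun v => ln (qpost mx mx' Sx Sx' (lsubmx v) (rsubmx v)) -
                 ln (prior w mu Sig Saug (lsubmx v) (rsubmx v)))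
    (1/4 * (\tr (invmx Saug *m (Sx + Sx')) + qform (mx - mx') (invmx Saug))
     - 1/2 * (ln (\det Sx) + ln (\det Sx')) - d%:R - d%:R / 2 * ln pi
     + 1/2 * ln (\det Saug) - a).
Proof.
move=> hSaug hSig hw hw1 ha.
have pSx := diag_posdef_sym _ hSx; have pSx' := diag_posdef_sym _ hSx'.
have p2S : sym_posdef (2 *: Saug) by exact: sym_posdefZ.
have trI (S : 'M[R]_d) : sym_posdef S -> \tr (invmx S *m S) = d%:R.
  by move=> pS; rewrite mulVmx ?mxtrace1// sym_posdef_unit.
have q0 (A : 'M[R]_d) : qform 0 A = 0 by rewrite /qform !mul0mx mxE.
have h1 := has_expectation_qform_comb 1 0 (- mx) (invmx Sx).
have h2 := has_expectation_qform_comb 0 1 (- mx') (invmx Sx').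
(* The prior evaluates its first factor at 0 with mean [z - z'], so the centred argument is
   [- z + z']. *)
have h3 := has_expectation_qform_comb (- 1) 1 0 (invmx (2 *: Saug)).
rewrite !scale0r !scale1r addr0 subrr q0 add0r expr1n expr0n/= scale0r scale1r addr0 trI// in h1.
rewrite !scale0r !scale1r add0r subrr q0 add0r expr1n expr0n/= scale0r scale1r add0r trI// in h2.
have iZ : invmx (2 *: Saug) = 2^-1 *: invmx Saug by rewrite invmxZ// sym_posdef_unit.
rewrite iZ qformZ addr0 scale1r scaleN1r sqrrN expr1n !scale1r -scalemxAl mxtraceZ in h3.
rewrite (_ : - mx + mx' = - (mx - mx')) ?qformN in h3; last by rewrite opprB addrC.
(* Normalising constants: two posterior factors minus one prior factor leave a single [d ln (2 pi)].
   Its [ln 2] cancels against the one in [ln (\det (2 *: Saug))], so only [ln pi] survives. *)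
have hk := has_expectation_cst (m := posterior_mean) posterior_std_neq0
  (- (1/2) * (d%:R * ln (2 * pi) + ln (\det Sx) + ln (\det Sx') - ln (\det (2 *: Saug)))).
have := has_expectationD (has_expectationZ (- (1/2)) h1)
  (has_expectationD (has_expectationZ (- (1/2)) h2)
  (has_expectationD (has_expectationZ (1/2) h3)
  (has_expectationD (has_expectationZ (-1) ha) hk))).
have ln2pi : ln (2 * pi) = ln 2 + ln pi :> R by rewrite lnM ?posrE ?pi_gt0.
have lnS : ln (\det (2 *: Saug)) = d%:R * ln 2 + ln (\det Saug).
  have p2 : (2 : R) ^+ d \is Num.pos by rewrite posrE exprn_gt0.
  have pd : \det Saug \is Num.pos by rewrite posrE sym_posdef_det_gt0.
  by rewrite detZ (lnM p2 pd) lnXn// mulr_natl.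
rewrite (_ : _ + (_ + _) = 1/4 * (\tr (invmx Saug *m (Sx + Sx')) + qform (mx - mx') (invmx Saug))
     - 1/2 * (ln (\det Sx) + ln (\det Sx')) - d%:R - d%:R / 2 * ln pi
     + 1/2 * ln (\det Saug) - a); last by rewrite ln2pi lnS; field.
apply: eq_has_expectation => v.
have gpos (y n : 'rV[R]_d) S : sym_posdef S -> gauss y n S \is Num.pos.
  by move=> pS; rewrite posrE gauss_gt0.
have mpos : mixture w mu Sig Saug (lsubmx v) (rsubmx v) \is Num.pos.
  by rewrite posrE mixture_gt0.
rewrite /qpost /prior (lnM (gpos _ _ _ pSx) (gpos _ _ _ pSx')) (lnM (gpos _ _ _ p2S) mpos).
rewrite !ln_gauss// iZ !scale0r !scale1r !addr0 add0r scaleN1r.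
rewrite sub0r opprB (addrC (- lsubmx v)).
by field.
Qed.

End posterior_expectation.

Theorem theorem2 (R : realType) (d : nat) (hd : (1 <= d)%N)
    (Saug : 'M[R]_d) (hSaug : sym_posdef Saug)
    (C : nat) (hC : (1 <= C)%N) (w : 'I_C -> R)
    (hw : forall c, 0 <= w c <= 1) (hw1 : \sum_(c < C) w c = 1)
    (mu : 'I_C -> 'rV[R]_d) (Sig : 'I_C -> 'M[R]_d)
    (hSig : forall c, sym_posdef (Sig c))
    (mx mx' : 'rV[R]_d) (Sx Sx' : 'M[R]_d)
    (hSx : diag_posdef Sx) (hSx' : diag_posdef Sx')
    (plik : 'rV[R]_d -> 'rV[R]_d -> R) :
  elbo plik mx mx' Sx Sx' w mu Sig Saug =
  (Eq mx mx' Sx Sx' (fun z z' => ln (plik z z'))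
   + Eq mx mx' Sx Sx' (fun z z' => ln (mixture w mu Sig Saug z z'))
   + (- (1/4) * (\tr (invmx Saug *m (Sx + Sx')) + qform (mx - mx') (invmx Saug))
      + (1/2) * (ln (\det Sx) + ln (\det Sx'))
      + d%:R + (d%:R / 2) * ln pi
      - (1/2) * ln (\det Saug))%:E)%E.
Proof.
have [a ha] := has_expectation_ln_mixture (mx := mx) (mx' := mx') hSx hSx' _ _ mu _ _ hSaug hSig hw hw1.
have hr := has_expectation_ln_ratio hSx hSx' _ _ _ _ _ _ hSaug hSig hw hw1 ha.
rewrite /elbo /KLq (EqE hSx hSx' _ _ ha).
rewrite (EqE hSx hSx' (fun z z' => ln (qpost mx mx' Sx Sx' z z') -
                                   ln (prior w mu Sig Saug z z')) _ hr).
(* The likelihood expectation stays an arbitrary extended real; only the finite terms after it are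
   regrouped. *)
rewrite -addeA -EFinN -EFinD; congr (_ + _%:E)%E.
by field.
Qed.
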